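(* Let $H_1,H_2$ be complex Hilbert spaces and let $\Phi,\Psi:K(H_1)\to K(H_2)$ be linear maps such that $\Phi$ is continuous and $(\Phi,\Psi)$ is Jordan-triple multiplicative. Then $\Phi$ admits a continuous normalized-pg-inverse.
   Context: $K(H)$ denotes the C$^*$-algebra of compact operators on the complex Hilbert space $H$. For linear maps $\Phi,\Psi:A\to B$ between complex Banach algebras, $\Psi$ is a normalized-pg-inverse of $\Phi$ (equivalently, the pair $(\Phi,\Psi)$ is Jordan-triple multiplicative) if $\Phi(aba)=\Phi(a)\Psi(b)\Phi(a)$ and $\Psi(aba)=\Psi(a)\Phi(b)\Psi(a)$ for all $a,b\in A$. Continuity is with respect to the norm topologies. *)

(* Defs.v *)
From HB Require Import structures.
From mathcomp Require Import all_boot all_order all_algebra.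
From mathcomp Require Import complex.
From mathcomp Require Import all_classical all_reals all_analysis.

Set Implicit Arguments.
Unset Strict Implicit.
Unset Printing Implicit Defensive.

Import Order.TTheory GRing.Theory Num.Theory.
Import numFieldNormedType.Exports.

Local Open Scope classical_set_scope.
Local Open Scope ring_scope.
Local Open Scope complex_scope.

(* Norms on a complex space take their values in R[i] (on its nonnegative
   real axis); the inner product is linear in its first argument. *)
HB.mixin Record NormedModule_isHilbert (R : realType) H
    of CompleteNormedModule R[i] H := {
  inner : {dot H for Num.conj};
  norm_inner : forall x : H, `|x| ^+ 2 = inner x x }.

#[short(type="hilbertType")]
HB.structure Definition Hilbert (R : realType) :=
  {H of CompleteNormedModule R[i] H & NormedModule_isHilbert R H}.

Section compact_operators.
Context {R : realType} {V : normedModType R[i]}.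
Implicit Types (f g : V -> V).

Definition unit_ball : set V := [set x | `|x| <= 1].

Definition is_compact_op : {pred V -> V} :=
  [pred f | `[< linear f /\ precompact (f @` unit_ball) >]].

Let precompact_img2 (h : V * V -> V) (A B C : set V) : continuous h ->
  precompact A -> precompact B ->
  (forall z, C z -> exists2 p, (A `*` B) p & z = h p) -> precompact C.
Proof.
move=> hc; rewrite !precompactE => cA cB CAB; rewrite -precompactE.
have cK : compact (h @` (closure A `*` closure B)).
  apply: continuous_compact; first exact: continuous_subspaceT.
  exact: compact_setX.
apply: (@precompact_subset _ _ (h @` (closure A `*` closure B))).
  move=> z /CAB[[x y] [/= Ax By] ->]; exists (x, y) => //.
  by split; exact: subset_closure.
by rewrite precompact_closed//; exact: (compact_closed (@norm_hausdorff _ V) cK).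
Qed.

Let is_compact_op_submod_closed : submod_closed is_compact_op.
Proof.
split.
- apply/asboolP; split; first by move=> a x y; rewrite /= scaler0 addr0.
  apply: (@precompact_subset _ _ [set 0]); first by move=> _ [x _ <-].
  by apply: compact_precompact; [exact: norm_hausdorff|exact: compact_set1].
- move=> a f g /asboolP[fL fc] /asboolP[gL gc]; apply/asboolP; split.
    move=> b x y; rewrite -[LHS]/(a *: f (b *: x + y) + g (b *: x + y)).
    rewrite -[RHS]/(b *: (a *: f x + g x) + (a *: f y + g y)) fL gL.
    by rewrite !scalerDr !scalerA (mulrC a) addrACA.
  apply: (@precompact_img2 (fun p => a *: p.1 + p.2) _ _ _ _ fc gc).
    move=> p; apply: cvgD; last exact: cvg_snd.
    by apply: cvgZl_tmp; exact: cvg_fst.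
  by move=> _ [x Bx <-]; exists (f x, g x) => //; split; exists x.
Qed.

HB.instance Definition _ := GRing.isSubmodClosed.Build _ _ is_compact_op
  is_compact_op_submod_closed.

End compact_operators.

Section compact_operator_space.
Context {R : realType} (V : normedModType R[i]).

Record compactOp := CompactOp {
  compact_fun :> V -> V;
  _ : compact_fun \in is_compact_op }.

HB.instance Definition _ := [isSub for compact_fun].
HB.instance Definition _ := [Choice of compactOp by <:].
HB.instance Definition _ := [SubChoice_isSubLmodule of compactOp by <:].

Implicit Types (f g : compactOp) (x : V).

Definition opnorm (f : V -> V) : R :=
  sup [set complex.Re `|f x| | x in unit_ball].

Let normE x : `|x| = (complex.Re `|x|)%:C.
Proof. by have /complex_realP[k ->] := normr_real x. Qed.

Let Renorm_continuous : continuous (fun x : V => complex.Re `|x|).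
Proof.
move=> x; apply/cvgrPdist_lt => e e0; near=> y.
have xy : `|x - y| < e%:C by near: y; apply: cvgr_dist_lt; rewrite ?ltcR.
have {}xy : complex.Re `|x - y| < e by rewrite -ltcR -normE.
apply: le_lt_trans xy; rewrite ler_distl -!lecR rmorphB rmorphD/= -!normE.
by rewrite lerBlDr -!lerBlDl {1}(distrC x) !lerB_dist.
Unshelve. all: by end_near. Qed.

Lemma compactOp_linear f : linear f.
Proof. by have /asboolP[] := valP f. Qed.

Lemma compactOp_bounded f :
  exists M : R, forall x, `|x| <= 1 -> `|f x| <= M%:C.
Proof.
have /asboolP[_] := valP f; rewrite precompactE => fc.
have /compact_bounded[M [_ MP]] : compact
    ((fun x : V => complex.Re `|x|) @` closure (f @` unit_ball)).
  by apply: continuous_compact fc; exact: continuous_subspaceT.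
exists (M + 1) => x x1; rewrite normE lecR.
apply: le_trans (MP (M + 1) _ _ _); [exact: ler_norm|by rewrite ltrDl|].
by exists (f x) => //; apply: subset_closure; exists x.
Qed.

Lemma opnorm_has_sup f :
  has_sup [set complex.Re `|f x| | x in unit_ball].
Proof.
split; first by exists (complex.Re `|f 0|), 0 => //; rewrite /unit_ball/= normr0.
have [M MP] := compactOp_bounded f; exists M => _ [x x1 <-].
by rewrite -lecR -normE; exact: MP.
Qed.

Lemma opnorm_ub f x : `|x| <= 1 -> `|f x| <= (opnorm f)%:C.
Proof.
move=> x1; rewrite normE lecR.
by apply: (ub_le_sup (opnorm_has_sup f).2); exists x.
Qed.

Lemma opnorm_le f (M : R) : (forall x, `|x| <= 1 -> `|f x| <= M%:C) ->
  opnorm f <= M.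
Proof.
move=> fM; apply: ge_sup; first exact: (opnorm_has_sup f).1.
by move=> _ [x x1 <-]; rewrite -lecR -normE; exact: fM.
Qed.

Let norm f : R[i] := (opnorm f)%:C.

Let norm_ge0 f : 0 <= norm f.
Proof.
by apply: le_trans (normr_ge0 (f 0)) (opnorm_ub _ _); rewrite normr0.
Qed.

Let ler_opnormD f g : norm (f + g) <= norm f + norm g.
Proof.
rewrite /norm -rmorphD lecR; apply: opnorm_le => x x1.
by rewrite rmorphD /=; apply: le_trans (ler_normD _ _) _; rewrite lerD ?opnorm_ub.
Qed.

Let le_normZ (l : R[i]) f : norm (l *: f) <= `|l| * norm f.
Proof.
have /complex_realP[k lk] := normr_real l.
rewrite /norm lk -rmorphM lecR; apply: opnorm_le => x x1.
by rewrite rmorphM /= normrZ -lk ler_wpM2l ?opnorm_ub.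
Qed.

Let opnormZ (l : R[i]) f : norm (l *: f) = `|l| * norm f.
Proof.
apply/le_anti; rewrite le_normZ /=; have [->|l0] := eqVneq l 0.
  by rewrite normr0 mul0r.
rewrite -ler_pdivlMl ?normr_gt0// -normfV.
by rewrite -[X in norm X <= _](scalerK l0); exact: le_normZ.
Qed.

Let opnorm0_eq0 f : norm f = 0 -> f = 0.
Proof.
move=> f0; apply/val_inj/funext => x /=.
have fB y : `|y| <= 1 -> f y = 0.
  by move=> y1; apply/eqP; rewrite -normr_le0 -f0 opnorm_ub.
have [->|x0] := eqVneq x 0; first by rewrite fB// normr0.
have nx0 : `|x| != 0 by rewrite normr_eq0.
have := compactOp_linear f `|x| (`|x|^-1 *: x) 0.
rewrite addr0 scalerA divff// scale1r => ->.
rewrite !fB ?normr0// ?scaler0 ?addr0//.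
by rewrite normrZ normfV normr_id mulVf.
Qed.

HB.instance Definition _ := Lmodule_isNormed.Build R[i] compactOp
  ler_opnormD opnormZ opnorm0_eq0.

Lemma compactOp_normE f : `|f| = (opnorm f)%:C. Proof. by []. Qed.

Lemma compactOp_continuous f : continuous f.
Proof.
have [M MP] := compactOp_bounded f.
pose F : {linear V -> V} :=
  HB.pack (f : V -> V) (GRing.isLinear.Build _ _ _ _ f (compactOp_linear f)).
apply: (@bounded_linear_continuous _ _ _ F); apply/ex_bound.
exists M%:C; apply/nbhs_norm0P; exists 1 => //= x /ltW; exact: MP.
Qed.

Lemma compact_comp_subproof f g : (f \o g) \in is_compact_op.
Proof.
apply/asboolP; split.
  by move=> a x y; rewrite /= !(compactOp_linear _ a x y) compactOp_linear.
have /asboolP[_] := valP g; rewrite precompactE => gc.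
have cfg : compact (f @` closure (g @` unit_ball)).
  apply: continuous_compact gc.
  exact/continuous_subspaceT/compactOp_continuous.
apply: precompact_subset (compact_precompact (@norm_hausdorff _ V) cfg).
by move=> _ [x x1 <-]; exists (g x) => //; apply: subset_closure; exists x.
Qed.

Definition compact_mul f g : compactOp := CompactOp (compact_comp_subproof f g).

End compact_operator_space.

Notation "f \*K g" := (compact_mul f g)
  (at level 40, left associativity, format "f  \*K  g") : ring_scope.

(* Equivalently: the pair (Phi, Psi) is Jordan-triple multiplicative. *)
Definition normalized_pg_inverse (R : realType) (H1 H2 : hilbertType R)
    (Phi Psi : {linear compactOp H1 -> compactOp H2}) : Prop :=
  (forall a b, Phi (a \*K b \*K a) = Phi a \*K Psi b \*K Phi a) /\
  (forall a b, Psi (a \*K b \*K a) = Psi a \*K Phi b \*K Psi a).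

(* Main.v *)
Require Import Defs.
From HB Require Import structures.
From mathcomp Require Import all_boot all_order all_algebra.
From mathcomp Require Import complex.
From mathcomp Require Import all_classical all_reals all_analysis.
From mathcomp Require Import ring lra.

(* Psi itself is continuous. The identity Psi (c d c) = Psi c Phi d Psi c
   makes d |-> Psi (c d c) bounded for each fixed c, so it suffices that every
   fast decreasing sequence (a_n) of compact operators factors as
   a_n = c d_n c with a common compact c and bounded compact d_n. If Psi were
   unbounded one could take |a_n| <= 16^-n with |Psi a_n| > n, a contradiction.

   For the factorization, choose increasing finite-rank orthogonal projections
   q_k, q_0 = 0, with |a_n - q_k a_n| and |a_n - a_n q_k| at most 16^-k for all
   n and k, and put e_k = q_(k+1) - q_k, c = sum_k 2^-k e_k. Then
   g_k = sum_(j <= k) 2^j e_j inverts c on the range of q_(k+1), and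
   d_n = sum_k g_k (q_(k+1) a_n q_(k+1) - q_k a_n q_k) g_k converges. *)

Set Implicit Arguments.
Unset Strict Implicit.
Unset Printing Implicit Defensive.

Import Order.TTheory GRing.Theory Num.Theory.
Import numFieldNormedType.Exports.

Local Open Scope classical_set_scope.
Local Open Scope ring_scope.
Local Open Scope complex_scope.

(** * Real-valued norms over complex scalars *)

(** Norms take values in [R[i]] but are real there; passing to the real part loses nothing and makes
    real order arithmetic available. *)
Definition rnorm {R : realType} {V : normedModType R[i]} (x : V) : R :=
  complex.Re `|x|.

Section RealNorm.
Context {R : realType} {V : normedModType R[i]}.
Implicit Types (x y : V) (e : R).

Lemma rnormE x : `|x| = (rnorm x)%:C.
Proof. by rewrite /rnorm; have /complex_realP[k ->] := normr_real x. Qed.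

Lemma rnorm_ge0 x : 0 <= rnorm x.
Proof. by rewrite -lecR -rnormE normr_ge0. Qed.

Lemma ler_rnormD x y : rnorm (x + y) <= rnorm x + rnorm y.
Proof. by rewrite -lecR rmorphD /= -!rnormE ler_normD. Qed.

Lemma rnormN x : rnorm (- x) = rnorm x.
Proof. by rewrite /rnorm normrN. Qed.

Lemma ler_rnormB x y : rnorm (x - y) <= rnorm x + rnorm y.
Proof. by rewrite -(rnormN y); exact: ler_rnormD. Qed.

Lemma rdistC x y : rnorm (x - y) = rnorm (y - x).
Proof. by rewrite -rnormN opprB. Qed.

Lemma ler_rdistD y x z : rnorm (x - z) <= rnorm (x - y) + rnorm (y - z).
Proof. by rewrite -[in leLHS](subrK y x) -addrA; exact: ler_rnormD. Qed.

Lemma rnorm0 : rnorm (0 : V) = 0.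
Proof. by rewrite /rnorm normr0. Qed.

Lemma rnorm_eq0 x : (rnorm x == 0) = (x == 0).
Proof.
apply/eqP/eqP => [x0|->]; last exact: rnorm0.
by apply/eqP; rewrite -normr_eq0 rnormE x0.
Qed.

Lemma rnorm_le0 x : rnorm x <= 0 -> x = 0.
Proof.
by move=> x0; apply/eqP; rewrite -rnorm_eq0 eq_le x0 rnorm_ge0.
Qed.

Lemma Re_normc_ge0 (l : R[i]) : 0 <= complex.Re `|l|.
Proof.
have /complex_realP[k lk] := normr_real l.
by rewrite -lecR lk /= -lk normr_ge0.
Qed.

Lemma rnormZ (l : R[i]) x : rnorm (l *: x) = complex.Re `|l| * rnorm x.
Proof.
have /complex_realP[k lk] := normr_real l.
by rewrite {1}/rnorm normrZ lk rnormE -rmorphM.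
Qed.

Lemma rnormZr (l : R) x : 0 <= l -> rnorm (l%:C *: x) = l * rnorm x.
Proof. by move=> l0; rewrite rnormZ ger0_norm ?ler0c. Qed.

Lemma ler_rnorm_sum (I : Type) (s : seq I) (F : I -> V) :
  rnorm (\sum_(i <- s) F i) <= \sum_(i <- s) rnorm (F i).
Proof.
elim: s => [|i s IH]; first by rewrite !big_nil rnorm0.
by rewrite !big_cons (le_trans (ler_rnormD _ _))// lerD2l.
Qed.

Lemma ball_rnorm x y e : ball x e%:C y <-> rnorm (x - y) < e.
Proof. by rewrite -ball_normE /ball_/= rnormE ltcR. Qed.

Lemma pos_complexP (eps : R[i]) : 0 < eps -> exists2 e : R, 0 < e & eps = e%:C.
Proof.
move=> e0; have /complex_realP[e eE] := gtr0_real e0.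
by exists e => //; move: e0; rewrite eE ltcR.
Qed.

Lemma ball_set x (B : set V) : nbhs x B ->
  exists2 e : R, 0 < e & forall y, rnorm (x - y) < e -> B y.
Proof.
move=> /nbhs_ballP[_ /= /pos_complexP[e e0 ->] eB].
by exists e => // y xy; apply/eB/ball_rnorm.
Qed.

Lemma nbhs_rnorm x e : 0 < e -> nbhs x [set y | rnorm (x - y) < e].
Proof.
move=> e0; apply/nbhs_ballP; exists e%:C => /=; first by rewrite ltcR.
by move=> y /ball_rnorm.
Qed.

End RealNorm.

(** * Geometric error rates *)

Section HalfPowers.
Context {R : realType}.

Definition halfpow (n : nat) : R := 2^-1 ^+ n.

Lemma halfpow_gt0 n : 0 < halfpow n.
Proof. by rewrite exprn_gt0// invr_gt0. Qed.

Lemma halfpow_ge0 n : 0 <= halfpow n.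
Proof. exact/ltW/halfpow_gt0. Qed.

Lemma halfpowS n : halfpow n.+1 = halfpow n / 2.
Proof. by rewrite /halfpow exprSr. Qed.

Lemma halfpow0 : halfpow 0 = 1.
Proof. by []. Qed.

Lemma halfpow_le m n : (m <= n)%N -> halfpow n <= halfpow m.
Proof.
move=> mn; rewrite /halfpow ler_wiXn2l//.
by rewrite invf_le1// ler1n.
Qed.

Lemma halfpow_small (C e : R) : 0 < e -> exists n, C * halfpow n < e.
Proof.
move=> e0.
have h1 : `|2^-1 : R| < 1 by rewrite ger0_norm ?invr_ge0// invf_lt1// ltr1n.
have /cvgrPdist_lt/(_ _ e0)[n _ /(_ n (leqnn n)) /= Hn] := cvg_geometric C h1.
exists n; apply: le_lt_trans Hn; rewrite sub0r normrN; exact: ler_norm.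
Qed.

(** Applied to the norm of a difference, this turns a geometric error bound directly into an
    equality of limits. *)
Lemma halfpow_le0 (C x : R) : (forall n, x <= C * halfpow n) -> x <= 0.
Proof.
move=> xC; rewrite leNgt; apply/negP => /(halfpow_small C)[n].
by rewrite ltNge xC.
Qed.

End HalfPowers.

(** * Linearity and operator norm estimates *)

Section CompactOpNorm.
Context {R : realType} {V : normedModType R[i]}.
Implicit Types (f g h : compactOp V) (x y : V).

Lemma compactOp0 f : f 0 = 0.
Proof.
by have := compactOp_linear f (-1) 0 0; rewrite !scaleN1r oppr0 addr0 addNr.
Qed.

Lemma compactOpD f x y : f (x + y) = f x + f y.
Proof. by have := compactOp_linear f 1 x y; rewrite !scale1r. Qed.

Lemma compactOpZ f l x : f (l *: x) = l *: f x.
Proof. by have := compactOp_linear f l x 0; rewrite compactOp0 !addr0. Qed.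

Lemma compactOpN f x : f (- x) = - f x.
Proof. by rewrite -scaleN1r compactOpZ scaleN1r. Qed.

Lemma compactOpB f x y : f (x - y) = f x - f y.
Proof. by rewrite compactOpD compactOpN. Qed.

Lemma compactOp_sum f (I : Type) (s : seq I) (F : I -> V) :
  f (\sum_(i <- s) F i) = \sum_(i <- s) f (F i).
Proof.
elim: s => [|i s IH]; first by rewrite !big_nil compactOp0.
by rewrite !big_cons compactOpD IH.
Qed.

Lemma sum_compactOpE (I : Type) (s : seq I) (F : I -> compactOp V) x :
  (\sum_(i <- s) F i) x = \sum_(i <- s) F i x.
Proof.
elim: s => [|i s IH]; first by rewrite !big_nil.
by rewrite !big_cons -IH.
Qed.

Lemma compactOpP f g : (forall x, f x = g x) -> f = g.
Proof. by move=> fg; apply/val_inj/funext. Qed.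

Lemma rnorm_app f x : rnorm (f x) <= rnorm f * rnorm x.
Proof.
have [->|x0] := eqVneq x 0; first by rewrite compactOp0 !rnorm0 mulr0.
have nx : 0 < rnorm x by rewrite lt_def rnorm_eq0 x0 rnorm_ge0.
have /(opnorm_ub f) : `|(rnorm x)^-1%:C *: x| <= 1.
  by rewrite rnormE rnormZr ?invr_ge0 ?rnorm_ge0// mulVf// gt_eqF.
rewrite compactOpZ rnormE lecR rnormZr ?invr_ge0 ?rnorm_ge0//.
by rewrite ler_pdivrMl// mulrC.
Qed.

Lemma rnorm_op_le f (M : R) : (forall x, rnorm (f x) <= M * rnorm x) ->
  0 <= M -> rnorm f <= M.
Proof.
move=> fM M0; apply: opnorm_le => x; rewrite !rnormE !lecR => x1.
by apply: le_trans (fM x) _; rewrite ler_piMr.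
Qed.

Lemma rnorm_mul f g : rnorm (f \*K g) <= rnorm f * rnorm g.
Proof.
apply: rnorm_op_le => [x|]; last by rewrite mulr_ge0 ?rnorm_ge0.
rewrite -mulrA; apply: le_trans (rnorm_app f (g x)) _.
by rewrite ler_wpM2l ?rnorm_ge0// rnorm_app.
Qed.

End CompactOpNorm.

(** * Uniform limits of compact operators and geometric series *)

Section Completeness.
Context {R : realType} {V : completeNormedModType R[i]}.

(** An ultrafilter on the closure of [A] is pushed into the closure of [K] by a choice of nearby
    points. The image clusters at some k, and the ultra property puts the original filter within e
    of k. It is thus Cauchy, and completeness gives its limit. *)
Lemma precompact_approx (A : set V) :
  (forall e : R, 0 < e -> exists2 K : set V, precompact K &
     forall x, A x -> exists2 y, K y & rnorm (x - y) < e) ->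
  precompact A.
Proof.
move=> AK; rewrite precompactE compact_ultra => F FU FA.
suff /cauchy_cvg/cvg_ex[/= p Fp] : cauchy F.
  exists p; split => //; apply: (closed_cvg (closure A)) Fp => //.
  exact: closed_closure.
apply/cauchyP => _ /pos_complexP[e e0 ->].
have e4 : 0 < e / 4 by rewrite divr_gt0.
have [K + Kapp] := AK _ e4; rewrite precompactE => Kc.
(* One e / 4 moves from the closure of [A] into [A], the other from [A] into [K]. *)
have {Kapp} Kapp x : exists y, closure A x -> closure K y /\ rnorm (x - y) < e / 2.
  have [Ax|nAx] := pselect (closure A x); last by exists 0.
  have [z [Az /= xz]] := Ax _ (nbhs_rnorm x e4).
  have [y Ky zy] := Kapp _ Az; exists y => _.
  split; first exact: subset_closure.
  by have := ler_rdistD z x y; lra.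
have [g gP] := choice Kapp.
have gFK : F (g @^-1` closure K) by apply: filterS FA => x /gP[].
have [k [_ kcl]] := Kc (g @ F) _ gFK.
have e2 : 0 < e / 2 by rewrite divr_gt0.
have [Fk|Fnk] := in_ultra_setVsetC [set x | rnorm (k - g x) < e / 2] FU.
  exists k; apply: filterS2 FA Fk => x /gP[_ xg] /= kg; apply/ball_rnorm.
  have := ler_rdistD (g x) k x; rewrite (rdistC (g x)); lra.
have [z []] := kcl (~` [set z | rnorm (k - z) < e / 2]) _ Fnk (nbhs_rnorm k e2).
by [].
Qed.

Lemma geometric_sum_cvg (u : nat -> V) (C : R) :
  (forall n, rnorm (u n) <= C * halfpow n) ->
  exists s, forall n, rnorm (s - \sum_(i < n) u i) <= 2 * C * halfpow n.
Proof.
move=> uC; pose S n := \sum_(i < n) u i.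
have C0 : 0 <= C.
  by have := uC 0%N; rewrite halfpow0 mulr1; apply: le_trans; exact: rnorm_ge0.
(* The subtracted term closes the induction: the next summand is at most C 2^-k with k = m + n,
   which is exactly the growth of the right side, as 2^-(k+1) is half of 2^-k. *)
have SD n m : rnorm (S (m + n)%N - S n) <= 2 * C * halfpow n - 2 * C * halfpow (m + n).
  elim: m => [|m IH]; first by rewrite add0n !subrr rnorm0.
  have -> : S (m.+1 + n)%N - S n = u (m + n)%N + (S (m + n)%N - S n).
    by rewrite addSn {1}/S big_ord_recr /= -/(S _) addrAC addrC.
  apply: le_trans (ler_rnormD _ _) _.
  have := uC (m + n)%N; rewrite addSn halfpowS; move: IH.
  by move: (halfpow (m + n)) => h; lra.
have SB n m : (n <= m)%N -> rnorm (S m - S n) <= 2 * C * halfpow n.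
  move=> nm; have := SD n (m - n)%N; rewrite subnK//.
  have : 0 <= 2 * C * halfpow m by rewrite !mulr_ge0// halfpow_ge0.
  lra.
have /cauchy_cvg/cvg_ex[/= s Ss] : cauchy (S @ \oo).
  apply/cauchyP => _ /pos_complexP[e e0 ->].
  have [n ne] := halfpow_small (2 * C) e0.
  exists (S n), n => // m /= nm; apply/ball_rnorm; rewrite rdistC.
  by apply: le_lt_trans ne; exact: SB.
exists s => n; apply/ler_addgt0Pr => e e0.
have [N _ NP] := Ss _ (nbhs_rnorm s e0).
have := NP (maxn n N) (leq_maxr _ _); rewrite /= => sS.
have := ler_rdistD (S (maxn n N)) s (S n).
by have := SB n _ (leq_maxl n N); rewrite -/(S n); lra.
Qed.

(** The limit is taken pointwise, at a rate proportional to |x|. This rate makes the limit linear,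
    and compact because the compact partial sums approach it uniformly on the unit ball. *)
Lemma geometric_compactOp_cvg (u : nat -> compactOp V) (C : R) :
  (forall n, rnorm (u n) <= C * halfpow n) ->
  exists s, forall n, rnorm (s - \sum_(i < n) u i) <= 2 * C * halfpow n.
Proof.
move=> uC; pose S n := \sum_(i < n) u i.
have C0 : 0 <= C.
  by have := uC 0%N; rewrite halfpow0 mulr1; apply: le_trans; exact: rnorm_ge0.
have ucvg x : exists y, forall n,
    rnorm (y - S n x) <= 2 * C * rnorm x * halfpow n.
  have uCx n : rnorm (u n x) <= (C * rnorm x) * halfpow n.
    by rewrite mulrAC; apply: le_trans (rnorm_app _ _) _; rewrite ler_wpM2r ?rnorm_ge0.
  have [y yP] := geometric_sum_cvg uCx.
  by exists y => n; rewrite /S sum_compactOpE -(mulrA 2).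
have [s sP] := choice ucvg.
have eq_lim (y z : V) (K : R) :
    (forall n, rnorm (y - z) <= K * halfpow n) -> y = z.
  by move=> yz; apply/subr0_eq/rnorm_le0/(halfpow_le0 yz).
have sL : linear s.
  move=> l x y; apply: (@eq_lim _ _ (2 * C * rnorm (l *: x + y) +
    complex.Re `|l| * (2 * C * rnorm x) + 2 * C * rnorm y)) => n.
  have -> : s (l *: x + y) - (l *: s x + s y) =
    (s (l *: x + y) - S n (l *: x + y)) - (l *: (s x - S n x) + (s y - S n y)).
    rewrite compactOpD compactOpZ scalerBr.
    rewrite [X in _ = _ - X]addrACA -opprD opprB addrA subrK//.
  apply: le_trans (ler_rnormB _ _) _; rewrite mulrDl (mulrDl _ _ (halfpow n)) -addrA.
  apply: lerD; first exact: sP.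
  apply: le_trans (ler_rnormD _ _) _; apply: lerD; last exact: sP.
  by rewrite rnormZ -[leRHS]mulrA ler_wpM2l// Re_normc_ge0.
have sc : s \in is_compact_op.
  apply/asboolP; split=> //; apply: precompact_approx => e e0.
  have [n nE] := halfpow_small (2 * C) e0.
  have /asboolP[_ Sc] := valP (S n).
  exists (S n @` unit_ball) => // _ [x x1 <-]; exists (S n x); first by exists x.
  apply: le_lt_trans nE; apply: le_trans (sP x n) _.
  have h0 : 0 <= 2 * C * halfpow n by rewrite !mulr_ge0// halfpow_ge0.
  rewrite mulrAC ler_piMr//.
  by move: x1; rewrite /unit_ball/= rnormE lecR.
exists (CompactOp sc) => n; apply: rnorm_op_le => [x|]; last first.
  by rewrite !mulr_ge0// halfpow_ge0.
by rewrite mulrAC; exact: sP.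
Qed.

End Completeness.

(** * Orthogonal projections of finite rank *)

Section Projections.
Context {R : realType} {H : hilbertType R}.
Implicit Types (x y e : H) (p q : compactOp H).

Lemma innerDl x y z : inner (x + y) z = inner x z + inner y z.
Proof. exact: linearDl. Qed.

Lemma innerBl x y z : inner (x - y) z = inner x z - inner y z.
Proof. exact: linearBl. Qed.

Lemma innerZl l x z : inner (l *: x) z = l * inner x z.
Proof. exact: linearZl_LR. Qed.

Lemma inner0l z : inner (0 : H) z = 0.
Proof. exact: linear0l. Qed.

Lemma innerC x y : inner x y = (inner y x)^*%R.
Proof. by rewrite hermC expr0 mul1r. Qed.

Lemma innerDr x y z : inner z (x + y) = inner z x + inner z y.
Proof. exact: linearDr. Qed.

Lemma innerZr l x z : inner z (l *: x) = l^* * inner z x.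
Proof. exact: linearZr_LR. Qed.

Lemma inner0r z : inner z (0 : H) = 0.
Proof. exact: linear0r. Qed.

Lemma rnorm_sqr x : (rnorm x ^+ 2)%:C = inner x x.
Proof. by rewrite rmorphXn /= -rnormE norm_inner. Qed.

Lemma rnorm_pythagoras x y : inner x y = 0 ->
  rnorm (x + y) ^+ 2 = rnorm x ^+ 2 + rnorm y ^+ 2.
Proof.
move=> xy; apply: (@complexI R).
by rewrite rmorphD /= !rnorm_sqr dnormD xy conjC0 !addr0.
Qed.

(** Pythagoras for the orthogonal decomposition of x into its component along e and the
    remainder. *)
Lemma inner_unit_le x e : rnorm e = 1 -> complex.Re `|inner x e| <= rnorm x.
Proof.
move=> e1; have ee : inner e e = 1 by rewrite -rnorm_sqr e1 expr1n.
set z := inner x e *: e.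
have /rnorm_pythagoras : inner z (x - z) = 0.
  by rewrite innerC innerBl /z !innerZr !innerZl ee mulr1 subrr rmorph0.
rewrite addrC subrK => xE.
rewrite -[leLHS]mulr1 -e1 -rnormZ -/z.
rewrite -(@ler_pXn2r _ 2%N) ?nnegrE ?rnorm_ge0// xE.
by rewrite lerDl sqr_ge0.
Qed.

(** On the unit ball the coefficient has modulus at most 1, so the image lies in that of the square
    [-1, 1]^2 under the continuous map (s, t) |-> s e + t i e. *)
Lemma compact_rank1 e : rnorm e = 1 ->
  exists p, forall x, p x = inner x e *: e.
Proof.
move=> e1; pose f x := inner x e *: e.
have fL : linear f.
  by move=> l x y; rewrite /f innerDl innerZl scalerDl scalerA.
have scalec (v : H) : continuous (fun t : R => t%:C *: v).
  move=> t; apply/cvg_ballP => _ /pos_complexP[d d0 ->].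
  have c0 : 0 < d / (rnorm v + 1) by rewrite divr_gt0// ltr_wpDl// rnorm_ge0.
  near=> s; apply/ball_rnorm; rewrite -scalerBl -rmorphB /= rnormZ.
  have st : `|t - s| < d / (rnorm v + 1) by near: s; exact: cvgr_dist_lt.
  rewrite normc_def /= expr0n addr0 sqrtr_sqr.
  move: st; rewrite ltr_pdivlMr ?ltr_wpDl ?rnorm_ge0//; apply: le_lt_trans.
  by rewrite ler_wpM2l// lerDl.
have hc : continuous (fun z : R * R => z.1%:C *: e + z.2%:C *: ('i *: e)).
  move=> z; apply: cvgD.
    apply: (@continuous_comp _ _ _ fst (fun t : R => t%:C *: e));
      last exact: scalec.
    exact: cvg_fst.
  apply: (@continuous_comp _ _ _ snd (fun t : R => t%:C *: ('i *: e)));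
    last exact: scalec.
  exact: cvg_snd.
have Kc : compact ((fun z : R * R => z.1%:C *: e + z.2%:C *: ('i *: e)) @`
    (`[-1, 1] `*` `[-1, 1])).
  apply: continuous_compact; first exact: continuous_subspaceT.
  by apply: compact_setX; exact: segment_compact.
have fC : f \in is_compact_op.
  apply/asboolP; split => //.
  apply: precompact_subset (compact_precompact (@norm_hausdorff _ H) Kc).
  move=> _ [x + <-]; rewrite /unit_ball/= rnormE lecR => x1.
  have xe1 := le_trans (inner_unit_le x e1) x1.
  exists (complex.Re (inner x e), complex.Im (inner x e)); last first.
    rewrite /f [in RHS](complexE (inner x e)) scalerDl scalerA /=.
    by rewrite (mulrC 'i).
  move: (inner x e) xe1 => z z1.
  have {}z1 : `|z| <= 1%:C by rewrite -[`|z|](@rnormE _ R[i]^o) lecR.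
  split; rewrite /= in_itv /= -ler_norml -lecR.
    exact: le_trans (normc_ge_Re z) z1.
  apply: le_trans z1; rewrite normc_def lecR -sqrtr_sqr.
  by rewrite ler_wsqrtr// lerDr sqr_ge0.
by exists (CompactOp fC).
Unshelve. all: by end_near.
Qed.

(** Since p is compact by its type, these are exactly the orthogonal projections of finite rank. *)
Definition is_orthoproj p :=
  (forall x, p (p x) = p x) /\ forall x y, inner (p x) y = inner x (p y).

Lemma orthoproj_ortho p x : is_orthoproj p -> inner (p x) (x - p x) = 0.
Proof.
by move=> [pp pC]; rewrite pC compactOpB pp subrr inner0r.
Qed.

Lemma orthoproj_sqr p x : is_orthoproj p ->
  rnorm x ^+ 2 = rnorm (p x) ^+ 2 + rnorm (x - p x) ^+ 2.
Proof.
by move=> /(orthoproj_ortho x)/rnorm_pythagoras <-; rewrite addrC subrK.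
Qed.

Lemma orthoproj_le p x : is_orthoproj p -> rnorm (p x) <= rnorm x.
Proof.
move=> /(orthoproj_sqr x) xE.
by rewrite -(@ler_pXn2r _ 2%N) ?nnegrE ?rnorm_ge0// xE lerDl sqr_ge0.
Qed.

Lemma orthoprojC_le p x : is_orthoproj p -> rnorm (x - p x) <= rnorm x.
Proof.
move=> /(orthoproj_sqr x) xE.
by rewrite -(@ler_pXn2r _ 2%N) ?nnegrE ?rnorm_ge0// xE lerDr sqr_ge0.
Qed.

(** Both products are recorded, so that neither has to be recovered from the other by taking
    adjoints. *)
Definition le_proj p q := forall x, q (p x) = p x /\ p (q x) = p x.

Lemma le_proj_refl p : is_orthoproj p -> le_proj p p.
Proof. by move=> [pp _] x. Qed.

Lemma le_proj_trans q p r : le_proj p q -> le_proj q r -> le_proj p r.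
Proof.
move=> pq qr x; split.
  by rewrite -(pq x).1 (qr _).1.
by rewrite -(pq (r x)).2 (qr x).2 (pq x).2.
Qed.

Lemma orthoproj0 : is_orthoproj 0.
Proof. by split => [x|x y]; rewrite ?inner0l ?inner0r. Qed.

(** Unless p already fixes y, add the rank-one projection onto the normalized component of y
    orthogonal to the range of p. *)
Lemma orthoproj_extend p y : is_orthoproj p ->
  exists q, [/\ is_orthoproj q, le_proj p q & q y = y].
Proof.
move=> pP; have [pp pC] := pP.
have [py|py] := eqVneq (p y) y; first by exists p; split => //; exact: le_proj_refl.
set z := y - p y; have z0 : z != 0 by rewrite subr_eq0 eq_sym.
have nz : 0 < rnorm z by rewrite lt_def rnorm_eq0 z0 rnorm_ge0.
pose e := (rnorm z)^-1%:C *: z.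
have ye : y = p y + (rnorm z)%:C *: e.
  by rewrite scalerA -rmorphM divff ?gt_eqF// scale1r addrC subrK.
have e1 : rnorm e = 1.
  by rewrite rnormZr ?invr_ge0 ?rnorm_ge0// mulVf// gt_eqF.
have pe : p e = 0 by rewrite compactOpZ compactOpB pp subrr scaler0.
have ee : inner e e = 1 by rewrite -rnorm_sqr e1 expr1n.
clearbody e.
have [r rE] := compact_rank1 e1.
have re : r e = e by rewrite rE ee scale1r.
have pr x : p (r x) = 0 by rewrite rE compactOpZ pe scaler0.
have rp x : r (p x) = 0 by rewrite rE pC pe inner0r scale0r.
have rr x : r (r x) = r x by rewrite [in LHS]rE rE innerZl /= ee mulr1.
have qE x : (p + r) x = p x + r x by [].
exists (p + r); split.
- split=> [x|x v]; first by rewrite !qE !compactOpD pp pr rp rr addr0 add0r.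
  rewrite !qE innerDl innerDr /= pC; congr (_ + _).
  by rewrite !rE innerZl innerZr -(innerC e v) mulrC.
- by move=> x; rewrite !qE !compactOpD pp pr rp !addr0.
- by rewrite {1}ye qE !compactOpD !compactOpZ pp pe re rp scaler0 addr0 add0r -ye.
Qed.

End Projections.

(** * Approximation of compact operators by finite-rank projections *)

Section Approximation.
Context {R : realType} {H : hilbertType R}.
Implicit Types (x y : H) (p q a : compactOp H).

(** Shared engine of the two contradiction arguments below: each bad vector is made harmless for all
    later projections by extending the current one to fix its image under [phi]. The left case takes
    [phi] = a, the right case the identity. *)
Lemma orthoproj_chain p (phi : H -> H) (Bad : compactOp H -> H -> Prop) :
  is_orthoproj p ->
  (forall q, is_orthoproj q -> le_proj p q -> exists x, Bad q x) ->
  exists (q : nat -> compactOp H) (x : nat -> H), forall n,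
    [/\ is_orthoproj (q n), Bad (q n) (x n) &
        forall m, (n < m)%N -> q m (phi (x n)) = phi (x n)].
Proof.
move=> pP badP.
have step q : exists s : H * compactOp H, is_orthoproj q -> le_proj p q ->
    [/\ Bad q s.1, is_orthoproj s.2, le_proj q s.2 & s.2 (phi s.1) = phi s.1].
  have [[qP pq]|nq] := pselect (is_orthoproj q /\ le_proj p q); last first.
    by exists (0, p) => qP pq; case: nq.
  have [x xP] := badP q qP pq; have [r [rP qr rx]] := orthoproj_extend (phi x) qP.
  by exists (x, r).
have [f fP] := choice step.
pose q n := iter n (fun r => (f r).2) p.
have qP n : is_orthoproj (q n) /\ le_proj p (q n).
  elim: n => [|n [qn pq]]; first by split => //; exact: le_proj_refl.
  by have [_ sP ns _] := fP _ qn pq; split => //; exact: le_proj_trans ns.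
exists q, (fun n => (f (q n)).1) => n; have [qn pq] := qP n.
have [Bn _ _ fixn] := fP _ qn pq.
split => // m; elim: m => // m IH; rewrite ltnS leq_eqVlt => /orP[/eqP <- //|nm].
by have [_ _ /(_ (phi (f (q n)).1))[+ _] _] := fP _ (qP m).1 (qP m).2; rewrite IH.
Qed.

Lemma precompact_seq_cluster (A : set H) (y : nat -> H) :
  precompact A -> (forall n, A (y n)) ->
  exists l, forall e : R, 0 < e ->
    forall N, exists2 n, (N <= n)%N & rnorm (y n - l) < e.
Proof.
rewrite precompactE => Ac Ay.
have yA : (y @ \oo) (closure A) by exists 0%N => // n _; exact: subset_closure.
have [l [_ lP]] := Ac (y @ \oo) _ yA.
exists l => e e0 N.
have yN : (y @ \oo) [set z | exists2 n, (N <= n)%N & z = y n].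
  by exists N => // n /= Nn; exists n.
have [_ [[n Nn ->] /= ln]] := lP _ _ yN (nbhs_rnorm l e0).
by exists n => //; rewrite rdistC.
Qed.

Lemma compactOp_precompact a : precompact (a @` unit_ball).
Proof. by have /asboolP[] := valP a. Qed.

(* Otherwise one finds x_n in the unit ball with each a x_m farther than e from
   the range of a projection fixing a x_n for all n < m, so (a x_n) does not
   cluster. *)
Lemma left_approx a p (e : R) : is_orthoproj p -> 0 < e ->
  exists q, [/\ is_orthoproj q, le_proj p q &
    forall x, rnorm (a x - q (a x)) <= e * rnorm x].
Proof.
move=> pP e0; apply: contrapT => nq.
have bad q : is_orthoproj q -> le_proj p q ->
    exists x, rnorm x <= 1 /\ e < rnorm (a x - q (a x)).
  move=> qP pq; apply: contrapT => nx; apply: nq; exists q; split => // x.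
  have [->|x0] := eqVneq x 0; first by rewrite !compactOp0 subrr !rnorm0 mulr0.
  have r0 : 0 < rnorm x by rewrite lt_def rnorm_eq0 x0 rnorm_ge0.
  rewrite leNgt; apply/negP => ex; apply: nx; exists ((rnorm x)^-1%:C *: x).
  rewrite !compactOpZ -scalerBr !rnormZr ?invr_ge0 ?rnorm_ge0//.
  by rewrite mulVf ?gt_eqF// ltr_pdivlMl// mulrC.
have [q [x qx]] := orthoproj_chain a pP bad.
have ax n : (a @` unit_ball) (a (x n)).
  have [_ [x1 _] _] := qx n; exists (x n) => //.
  by rewrite /unit_ball/= rnormE lecR.
have [l lP] := precompact_seq_cluster (compactOp_precompact a) ax.
have e2 : 0 < e / 2 by rewrite divr_gt0.
have [n _ nl] := lP _ e2 0%N; have [m nm ml] := lP _ e2 n.+1.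
have [qP [_ em] _] := qx m; have [_ _ /(_ _ nm) fixn] := qx n.
have : rnorm (a (x m) - a (x n)) < e.
  have := ler_rdistD l (a (x m)) (a (x n)); rewrite (rdistC l); lra.
(* As q_m fixes a x_n, the vector (1 - q_m) (a x_m) equals (1 - q_m) (a x_m - a x_n), whose norm is
   below e. *)
have := orthoprojC_le (a (x m) - a (x n)) qP.
rewrite compactOpB fixn opprB addrA subrK => h1 h2.
by have := lt_trans em (le_lt_trans h1 h2); rewrite ltxx.
Qed.

(* Otherwise there are orthonormal x_n with |a x_n| > e for all n. Many of the
   a x_n lie close to a single l, so the sum w of N of these x_n has norm
   sqrt N while |a w| grows like N |l|. *)
Lemma right_approx a p (e : R) : is_orthoproj p -> 0 < e ->
  exists q, [/\ is_orthoproj q, le_proj p q &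
    forall x, rnorm (a x - a (q x)) <= e * rnorm x].
Proof.
move=> pP e0; apply: contrapT => nq.
have bad q : is_orthoproj q -> le_proj p q ->
    exists x, [/\ q x = 0, rnorm x = 1 & e < rnorm (a x)].
  move=> qP pq; apply: contrapT => nx; apply: nq; exists q; split => // x.
  rewrite leNgt; apply/negP => ex; apply: nx.
  have x0 : x - q x != 0.
    apply/eqP => x0; move: ex; rewrite -compactOpB x0 compactOp0 rnorm0 ltNge.
    by rewrite mulr_ge0 ?rnorm_ge0// ltW.
  have r0 : 0 < rnorm (x - q x) by rewrite lt_def rnorm_eq0 x0 rnorm_ge0.
  exists ((rnorm (x - q x))^-1%:C *: (x - q x)).
  rewrite !compactOpZ !rnormZr ?invr_ge0 ?rnorm_ge0// mulVf ?gt_eqF//; split => //.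
    by rewrite compactOpB qP.1 subrr scaler0.
  rewrite ltr_pdivlMl// mulrC compactOpB; apply: le_lt_trans ex.
  by rewrite ler_wpM2l ?(ltW e0)// orthoprojC_le.
have [q [x qx]] := orthoproj_chain id pP bad.
have ax n : (a @` unit_ball) (a (x n)).
  have [_ [_ x1 _] _] := qx n; exists (x n) => //.
  by rewrite /unit_ball/= rnormE lecR x1.
have xx k n : (k < n)%N -> inner (x k) (x n) = 0.
  have [_ _ /[apply]] := qx k => /= <-.
  by have [qP [qn _ _] _] := qx n; rewrite qP.2 qn inner0r.
have [l lP] := precompact_seq_cluster (compactOp_precompact a) ax.
have e4 : 0 < e / 4 by rewrite divr_gt0.
(* w is built as a sum of N of the x_n with indices below m, so any later x_n is orthogonal to it
   and can be added by Pythagoras. *)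
have wP N : exists w m, [/\ rnorm w ^+ 2 = N%:R,
    rnorm (a w - N%:R%:C *: l) <= N%:R * (e / 4) &
    forall n, (m <= n)%N -> inner w (x n) = 0].
  elim: N => [|N [w [m [wN wl wx]]]].
    exists 0, 0%N; rewrite compactOp0 scale0r subrr !rnorm0 expr0n mul0r.
    by split => // n _; rewrite inner0l.
  have [n mn nl] := lP _ e4 m.
  have [_ [_ xn1 _] _] := qx n.
  exists (w + x n), n.+1; split.
  - by rewrite rnorm_pythagoras ?wx// wN xn1 expr1n natr1.
  - rewrite -natr1 rmorphD /= scalerDl scale1r compactOpD opprD addrACA.
    by apply: le_trans (ler_rnormD _ _) _; rewrite mulrDl mul1r lerD// ltW.
  - move=> k nk; rewrite innerDl wx ?xx ?addr0//.
    by apply: leq_trans mn _; exact: ltnW.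
have l3 : 3 * (e / 4) <= rnorm l.
  have [n _ nl] := lP _ e4 0%N; have [_ [_ _ an] _] := qx n.
  by have := ler_rnormD (a (x n) - l) l; rewrite subrK; lra.
(* From |l| >= 3e/4 and the error N e/4 one gets N e/2 <= |a w| <= |a| sqrt N, that is N e^2 <= 4
   |a|^2; this N violates it. *)
pose N := (Num.bound (4 * rnorm a ^+ 2 / e ^+ 2)).+1.
have [w [_ [wN wl _]]] := wP N.
have aw : N%:R * (e / 2) <= rnorm (a w).
  have := ler_rdistD (a w) (N%:R%:C *: l) 0; rewrite !subr0 rdistC.
  rewrite rnormZr ?ler0n// => h; have : N%:R * (3 * (e / 4)) <= N%:R * rnorm l.
    by rewrite ler_wpM2l.
  by move: wl h; lra.
have N0 : (0 : R) < N%:R by rewrite ltr0n.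
have /archi_boundP Nlt : 0 <= 4 * rnorm a ^+ 2 / e ^+ 2.
  apply: divr_ge0; last exact: sqr_ge0.
  by apply: mulr_ge0; [exact: ler0n|exact: sqr_ge0].
have h : 4 * rnorm a ^+ 2 < N%:R * e ^+ 2.
  by rewrite -ltr_pdivrMr ?exprn_gt0//; apply: lt_le_trans Nlt _; rewrite ler_nat.
have : (N%:R * (e / 2)) ^+ 2 <= rnorm a ^+ 2 * N%:R.
  rewrite -[in leRHS]wN -exprMn ler_pXn2r ?nnegrE ?mulr_ge0 ?rnorm_ge0//
    ?divr_ge0 ?(ltW e0)//.
  exact: le_trans aw (rnorm_app _ _).
have -> : (N%:R * (e / 2)) ^+ 2 = N%:R * (N%:R * e ^+ 2 / 4) by field.
by rewrite [leRHS]mulrC ler_pM2l//; move: h; lra.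
Qed.

Definition almost_fixed q a (e : R) := forall x,
  rnorm (a x - q (a x)) <= e * rnorm x /\ rnorm (a x - a (q x)) <= e * rnorm x.

(** For p <= q, (1 - q) a = (1 - q) (1 - p) a and a (1 - q) = a (1 - p) (1 - q), and 1 - q is a
    contraction. *)
Lemma almost_fixedW p q a (e : R) : is_orthoproj q -> le_proj p q -> 0 <= e ->
  almost_fixed p a e -> almost_fixed q a e.
Proof.
move=> qP pq e0 pa x; split.
  have := orthoprojC_le (a x - p (a x)) qP.
  rewrite compactOpB (pq _).1 opprB addrA subrK => h.
  exact: le_trans h (pa x).1.
have := (pa (x - q x)).2; rewrite [p _]compactOpB (pq x).2.
rewrite -{2}[p x](pq x).2 (pq x).2 subrr compactOp0 subr0 compactOpB => h.
by apply: le_trans h _; rewrite ler_wpM2l// orthoprojC_le.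
Qed.

Lemma exists_almost_fixed a p (e : R) : is_orthoproj p -> 0 < e ->
  exists q, [/\ is_orthoproj q, le_proj p q & almost_fixed q a e].
Proof.
move=> pP e0; have [q [qP pq qa]] := left_approx a pP e0.
have [r [rP qr ra]] := right_approx a qP e0.
exists r; split => //; first exact: le_proj_trans qr.
move=> x; split; last exact: ra.
have := orthoprojC_le (a x - q (a x)) rP.
rewrite compactOpB (qr _).1 opprB addrA subrK => h.
exact: le_trans h (qa x).
Qed.

Lemma exists_almost_fixed_seq (a : nat -> compactOp H) n p (e : R) :
  is_orthoproj p -> 0 < e ->
  exists q, [/\ is_orthoproj q, le_proj p q &
    forall i, (i < n)%N -> almost_fixed q (a i) e].
Proof.
move=> pP e0; elim: n => [|n [q [qP pq qa]]].
  by exists p; split => //; exact: le_proj_refl.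
have [r [rP qr ra]] := exists_almost_fixed (a n) qP e0.
exists r; split => //; first exact: le_proj_trans qr.
move=> i; rewrite ltnS leq_eqVlt => /orP[/eqP -> //|/qa].
by apply: almost_fixedW => //; exact: ltW.
Qed.

Lemma almost_fixed_small a q (e : R) : is_orthoproj q -> rnorm a <= e ->
  almost_fixed q a e.
Proof.
move=> qP ae x; split.
  apply: le_trans (orthoprojC_le _ qP) _; apply: le_trans (rnorm_app _ _) _.
  by rewrite ler_wpM2r ?rnorm_ge0.
rewrite -compactOpB; apply: le_trans (rnorm_app _ _) _.
by apply: ler_pM; rewrite ?rnorm_ge0 ?orthoprojC_le.
Qed.

(** Only the finitely many a_n with n < k constrain q_k. For n >= k the operator a_n already has
    norm at most [eps k], so every projection almost fixes it; this also allows q_0 = 0. *)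
Lemma almost_fixed_chain (a : nat -> compactOp H) (eps : nat -> R) :
  (forall n, 0 < eps n) -> {homo eps : m n / (m <= n)%N >-> n <= m} ->
  (forall n, rnorm (a n) <= eps n) ->
  exists q : nat -> compactOp H, [/\ q 0%N = 0, forall k, is_orthoproj (q k),
    forall k, le_proj (q k) (q k.+1) & forall n k, almost_fixed (q k) (a n) (eps k)].
Proof.
move=> eps0 epsle ae.
have step (s : nat * compactOp H) : exists q, is_orthoproj s.2 ->
    [/\ is_orthoproj q, le_proj s.2 q &
      forall i, (i < s.1.+1)%N -> almost_fixed q (a i) (eps s.1.+1)].
  have [sP|ns] := pselect (is_orthoproj s.2); last by exists 0.
  by have [q qP] := exists_almost_fixed_seq a s.1.+1 sP (eps0 s.1.+1); exists q.
have [f fP] := choice step.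
pose q := fix q n := if n is k.+1 then f (k, q k) else 0.
have qP k : is_orthoproj (q k).
  elim: k => [|k IH]; first exact: orthoproj0.
  by have [] := fP (k, q k) IH.
exists q; split => // [k|n k]; first by have [] := fP (k, q k) (qP k).
have [kn|nk] := leqP k n.
  by apply: almost_fixed_small => //; apply: le_trans (ae n) (epsle _ _ kn).
by case: k nk => // k nk; have [_ _] := fP (k, q k) (qP k); exact.
Qed.

End Approximation.

(** * Factorization through a common diagonal weight *)

Section Factorization.
Context {R : realType} {H : hilbertType R}.
Context (q : nat -> compactOp H) (q0 : q 0%N = 0)
  (qP : forall k, is_orthoproj (q k)) (qle : forall k, le_proj (q k) (q k.+1)).

Let e k := q k.+1 - q k.

Let q_mono m n : (m <= n)%N -> le_proj (q m) (q n).
Proof.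
elim: n => [|n IH]; first by rewrite leqn0 => /eqP ->; exact: le_proj_refl.
rewrite leq_eqVlt => /orP[/eqP -> |]; first exact: le_proj_refl.
by rewrite ltnS => /IH/le_proj_trans; apply.
Qed.

Let eE k x : e k x = q k.+1 x - q k x. Proof. by []. Qed.

Let ee k x : e k (e k x) = e k x.
Proof.
rewrite !eE !compactOpB (qP k.+1).1 (qP k).1 (qle k x).1 (qle k x).2.
by rewrite subrr subr0.
Qed.

Let ee0 i j x : i != j -> e i (e j x) = 0.
Proof.
rewrite neq_ltn => /orP[ij|ji]; rewrite !eE !compactOpB.
  rewrite (q_mono ij x).2 (q_mono (ltnW ij) x).2.
  rewrite (q_mono (leqW ij) x).2 (q_mono (ltnW (leqW ij)) x).2.
  by rewrite !subrr.
rewrite (q_mono ji x).1 (q_mono (ltnW ji) x).1.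
by rewrite (q_mono (leqW ji) x).1 (q_mono (ltnW (leqW ji)) x).1 subrr.
Qed.

Let rnorm_e k : rnorm (e k) <= 2.
Proof.
have q1 m : rnorm (q m) <= 1.
  by apply: rnorm_op_le => // x; rewrite mul1r; exact: orthoproj_le.
by apply: le_trans (ler_rnormB _ _) _; have := q1 k; have := q1 k.+1; lra.
Qed.

Let sum_e n x : \sum_(i < n) e i x = q n x.
Proof.
rewrite -(big_mkord xpredT (fun i => e i x)).
by rewrite (telescope_sumr (fun i => q i x))// q0 subr0.
Qed.

(** The e_k are mutually orthogonal projections, so multiplying a partial sum of c by e_k on either
    side leaves a single term, and the geometric rate carries the identity over to c. Each g then
    inverts finitely many diagonal entries. *)
Lemma exists_weight : exists c : compactOp H, forall k, exists g : compactOp H,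
  rnorm g * halfpow k <= 4 /\
  forall x, c (g x) = q k.+1 x /\ g (c x) = q k.+1 x.
Proof.
pose u k := (halfpow k)%:C *: e k.
have uC k : rnorm (u k) <= 2 * halfpow k.
  by rewrite rnormZr ?halfpow_ge0// mulrC ler_wpM2r ?halfpow_ge0.
have [c cP] := geometric_compactOp_cvg uC.
pose S n := \sum_(i < n) u i.
have SE n x : S n x = \sum_(i < n) (halfpow i)%:C *: e i x.
  by rewrite /S sum_compactOpE.
have pick k n (F : nat -> H) : (k < n)%N -> (forall i, i != k -> F i = 0) ->
    \sum_(i < n) F i = F k.
  move=> kn Fk; rewrite (bigD1 (Ordinal kn))//= big1 ?addr0// => i ik.
  by apply: Fk; apply: contra ik => /eqP ik; apply/eqP/val_inj.
have cS n x : rnorm (c x - S n x) <= 2 * 2 * halfpow n * rnorm x.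
  have -> : c x - S n x = (c - S n) x by [].
  apply: le_trans (rnorm_app _ _) _; rewrite ler_wpM2r ?rnorm_ge0//; exact: cP.
(* The estimate is required only for n > k, where the partial sum contains the k-th term; hence the
   shift by k + 1. *)
have eq_lim k (y z : H) (K : R) : 0 <= K ->
    (forall n, (k < n)%N -> rnorm (y - z) <= K * halfpow n) -> y = z.
  move=> K0 yz; apply/subr0_eq/rnorm_le0/(@halfpow_le0 R K) => n.
  apply: le_trans (yz (k.+1 + n)%N _) _; first by rewrite ltnS leq_addr.
  by rewrite ler_wpM2l// halfpow_le// leq_addl.
have ce k x : c (e k x) = (halfpow k)%:C *: e k x.
  apply: (@eq_lim k _ _ (2 * 2 * rnorm (e k x))) => [|n kn].
    by rewrite mulr_ge0 ?rnorm_ge0.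
  have := cS n (e k x).
  rewrite SE (pick k _ (fun i => (halfpow i)%:C *: e i (e k x)))//; last first.
    by move=> i ik; rewrite ee0// scaler0.
  by rewrite ee mulrAC.
have ec k x : e k (c x) = (halfpow k)%:C *: e k x.
  apply: (@eq_lim k _ _ (2 * (2 * 2 * rnorm x))) => [|n kn].
    by rewrite !mulr_ge0 ?rnorm_ge0.
  have -> : (halfpow k)%:C *: e k x = e k (S n x).
    rewrite SE compactOp_sum (pick k _ (fun i => e k ((halfpow i)%:C *: e i x)))//.
      by rewrite compactOpZ ee.
    by move=> i ik; rewrite compactOpZ ee0 ?scaler0// eq_sym.
  rewrite -compactOpB; apply: le_trans (rnorm_app _ _) _.
  apply: (@le_trans _ _ (2 * (2 * 2 * halfpow n * rnorm x))); last by lra.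
  by apply: ler_pM; [exact: rnorm_ge0|exact: rnorm_ge0|exact: rnorm_e|exact: cS].
exists c => k; pose g := \sum_(j < k.+1) ((halfpow j)^-1)%:C *: e j.
have hV j (v : H) : (halfpow j)^-1%:C *: ((halfpow j)%:C *: v) = v.
  by rewrite scalerA -rmorphM mulVf ?scale1r// gt_eqF// halfpow_gt0.
exists g; split; last first.
  move=> x; rewrite -sum_e !sum_compactOpE compactOp_sum; split.
    by apply: eq_bigr => j _; rewrite compactOpZ ce hV.
  by apply: eq_bigr => j _; rewrite -[LHS]/(_ *: e j (c x)) ec hV.
rewrite -ler_pdivlMr ?halfpow_gt0//; apply: le_trans (ler_rnorm_sum _ _) _.
rewrite {}/g {ce ec hV}; elim: k => [|k IH].
  rewrite big_ord1 /= halfpow0 invr1 scale1r mulr1.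
  by have := rnorm_e 0; lra.
have hV0 : 0 <= (halfpow k.+1)^-1 :> R by rewrite invr_ge0 halfpow_ge0.
have last_le : rnorm ((halfpow k.+1)^-1%:C *: e k.+1) <= (halfpow k.+1)^-1 * 2.
  by rewrite rnormZr// ler_wpM2l.
rewrite big_ord_recr /=; apply: le_trans (lerD IH last_le) _.
(* The bounds add up exactly: 4 * 2^k + 2 * 2^(k+1) = 4 * 2^(k+1). *)
rewrite halfpowS le_eqVlt; apply/orP; left; apply/eqP.
by field; rewrite gt_eqF// halfpow_gt0.
Qed.

(** The fourth power pays for both factors g_k: |b_k| <= 4 * 16^-k and |g_k| <= 4 * 2^k give |g_k
    b_k g_k| <= 64 * 4^-k, still summable. The bound 128 is twice 64, from the geometric series. *)
Lemma factor_of_weight (c a : compactOp H) :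
  (forall k, exists g : compactOp H, rnorm g * halfpow k <= 4 /\
     forall x, c (g x) = q k.+1 x /\ g (c x) = q k.+1 x) ->
  (forall k, almost_fixed (q k) a (halfpow k ^+ 4)) ->
  exists2 d : compactOp H, rnorm d <= 128 & a = c \*K d \*K c.
Proof.
move=> /choice[g gP] qa.
pose t k := q k \*K a \*K q k; pose b k := t k.+1 - t k.
have h0 k : (0 : R) < halfpow k by exact: halfpow_gt0.
have h1 k : halfpow k <= 1 :> R by rewrite -[leRHS]halfpow0 halfpow_le.
have tE k x : t k x = q k (a (q k x)) by [].
have bE k x : b k x = t k.+1 x - t k x by [].
have at_ k x : rnorm (a x - t k x) <= 2 * halfpow k ^+ 4 * rnorm x.
  have -> : a x - t k x = (a x - q k (a x)) + q k (a x - a (q k x)).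
    by rewrite compactOpB; exact/esym/subrKA.
  apply: le_trans (ler_rnormD _ _) _; have [] := qa k x.
  by have := orthoproj_le (a x - a (q k x)) (qP k); lra.
have bn k : rnorm (b k) <= 4 * halfpow k ^+ 4.
  apply: rnorm_op_le => [x|]; last by rewrite mulr_ge0// exprn_ge0// ltW.
  have -> : b k x = (a x - t k x) - (a x - t k.+1 x).
    by rewrite bE opprB [RHS]addrC subrKA.
  apply: le_trans (ler_rnormB _ _) _; have := at_ k x; have := at_ k.+1 x.
  have : halfpow k.+1 ^+ 4 * rnorm x <= halfpow k ^+ 4 * rnorm x.
    by rewrite ler_wpM2r ?rnorm_ge0// lerXn2r ?nnegrE ?(ltW (h0 _))// halfpow_le.
  lra.
pose G k := g k \*K b k \*K g k.
have GC k : rnorm (G k) <= 64 * halfpow k.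
  have [gk _] := gP k; have r0 := rnorm_ge0 (g k).
  apply: le_trans (rnorm_mul _ _) _.
  apply: le_trans (ler_wpM2r r0 (rnorm_mul _ _)) _.
  apply: (@le_trans _ _ (rnorm (g k) * (4 * halfpow k ^+ 4) * rnorm (g k))).
    by rewrite ler_wpM2r// ler_wpM2l.
  have -> : rnorm (g k) * (4 * halfpow k ^+ 4) * rnorm (g k) =
      4 * (rnorm (g k) * halfpow k) ^+ 2 * halfpow k ^+ 2 by ring.
  have gh2 : (rnorm (g k) * halfpow k) ^+ 2 <= 4 ^+ 2.
    by rewrite lerXn2r ?nnegrE ?mulr_ge0 ?(ltW (h0 _)).
  have hh : halfpow k ^+ 2 <= halfpow k :> R.
    by rewrite expr2 ler_piMr// ltW.
  apply: (@le_trans _ _ (4 * 4 ^+ 2 * halfpow k ^+ 2)).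
    by rewrite ler_wpM2r ?sqr_ge0// ler_wpM2l.
  by lra.
have [d dP] := geometric_compactOp_cvg GC.
exists d; first by have := dP 0%N; rewrite big_ord0 subr0 halfpow0; lra.
apply: compactOpP => x; apply/subr0_eq/rnorm_le0.
(* The 2 comes from a - t_n, the other summand from the tail of the series for d placed between two
   factors c. *)
apply: (@halfpow_le0 R ((2 + rnorm c * 128 * rnorm c) * rnorm x)) => n.
(* Both c g_i and g_i c act as q_(i+1), which leaves b_i unchanged on either side; the sum then
   telescopes from t_0 = 0. *)
have ctc : c ((\sum_(i < n) G i) (c x)) = t n x.
  rewrite sum_compactOpE compactOp_sum.
  have -> : \sum_(i < n) c (G i (c x)) = \sum_(i < n) (t i.+1 x - t i x).
    apply: eq_bigr => i _; rewrite -[G i _]/(g i (b i (g i (c x)))).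
    rewrite ((gP i).2 _).1 ((gP i).2 _).2 bE !tE compactOpB.
    by rewrite !(qP i.+1).1 (qle i _).1 (qle i _).2.
  rewrite -(big_mkord xpredT (fun i => t i.+1 x - t i x)).
  by rewrite (telescope_sumr (fun i => t i x))// [t 0%N x]tE q0 subr0.
have hn4 : halfpow n ^+ 4 <= halfpow n :> R.
  by rewrite exprS ler_piMr ?(ltW (h0 n))// exprn_ile1// ltW.
have := ler_rdistD (t n x) (a x) ((c \*K d \*K c) x).
rewrite -{2}ctc -[(c \*K d \*K c) x]/(c (d (c x))) -compactOpB.
have atn : rnorm (a x - t n x) <= 2 * halfpow n * rnorm x.
  apply: le_trans (at_ n x) _.
  by rewrite ler_wpM2r ?rnorm_ge0// ler_wpM2l.
have tc : rnorm (c ((\sum_(i < n) G i) (c x) - d (c x))) <=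
    rnorm c * (128 * halfpow n * (rnorm c * rnorm x)).
  apply: le_trans (rnorm_app _ _) _; rewrite ler_wpM2l ?rnorm_ge0//.
  rewrite rdistC -[_ - _]/((d - \sum_(i < n) G i) (c x)).
  apply: le_trans (rnorm_app _ _) _.
  apply: ler_pM; rewrite ?rnorm_ge0 ?rnorm_app//.
  by apply: le_trans (dP n) _; lra.
by lra.
Qed.

End Factorization.

Lemma common_factor (R : realType) (H : hilbertType R) (a : nat -> compactOp H) :
  (forall n, rnorm (a n) <= halfpow n ^+ 4) ->
  exists c : compactOp H, forall n,
    exists2 d : compactOp H, rnorm d <= 128 & a n = c \*K d \*K c.
Proof.
move=> an.
have hp (n : nat) : (0 : R) < halfpow n ^+ 4 by rewrite exprn_gt0// halfpow_gt0.
have hle : {homo (fun n => halfpow n ^+ 4 : R) : m n / (m <= n)%N >-> n <= m}.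
  by move=> m n mn; rewrite lerXn2r ?nnegrE ?(ltW (halfpow_gt0 _))// halfpow_le.
have [q [q0 qP qle qa]] := almost_fixed_chain hp hle an.
have [c cP] := exists_weight q0 qP qle.
by exists c => n; exact: factor_of_weight cP (qa n).
Qed.

(** * Boundedness and automatic continuity *)

Lemma compactOp_linear_continuousP (R : realType) (H1 H2 : hilbertType R)
    (F : {linear compactOp H1 -> compactOp H2}) :
  continuous F <-> exists M : R, forall a, rnorm (F a) <= M * rnorm a.
Proof.
split=> [/(_ 0) Fc|[M FM]].
  have [|d d0 dP] := ball_set (Fc [set y | rnorm (F 0 - y) < 1] _).
    exact: nbhs_rnorm.
  exists (2 / d) => a; have [->|a0] := eqVneq a 0.
    by rewrite linear0 !rnorm0 mulr0.
  have ra : 0 < rnorm a by rewrite lt_def rnorm_eq0 a0 rnorm_ge0.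
  (* Rescales a to norm d / 2, inside the ball where F has norm below 1. *)
  pose l : R := d / 2 / rnorm a.
  have l0 : 0 < l by rewrite !divr_gt0.
  have /dP/ltW : rnorm (0 - l%:C *: a) < d.
    rewrite sub0r rnormN rnormZr ?(ltW l0)// divfK ?gt_eqF//; lra.
  rewrite /= linear0 sub0r rnormN linearZ rnormZr ?(ltW l0)// => h.
  have -> : 2 / d * rnorm a = l^-1.
    by rewrite /l; field; rewrite !gt_eqF.
  by rewrite -[l^-1]mul1r ler_pdivlMr// mulrC.
apply: bounded_linear_continuous; apply/ex_bound.
exists (`|M|)%:C; apply/nbhs_ballP; exists 1 => //= a.
move=> /(@ball_rnorm _ _ _ _ 1); rewrite sub0r rnormN /= => a1.
rewrite rnormE lecR; apply: le_trans (FM a) _.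
apply: le_trans (ler_wpM2r (rnorm_ge0 a) (ler_norm M)) _.
by rewrite ler_piMr// ltW.
Qed.

Unset Implicit Arguments.

Theorem theorem3p4 (R : realType) (H1 H2 : hilbertType R)
    (Phi Psi : {linear compactOp H1 -> compactOp H2})
    (Phi_continuous : continuous Phi)
    (Phi_Psi_jordan_triple : normalized_pg_inverse Phi Psi) :
  exists2 Theta : {linear compactOp H1 -> compactOp H2},
    continuous Theta & normalized_pg_inverse Phi Theta.
Proof.
exists Psi => //; apply/compactOp_linear_continuousP.
have [M PhiM] := (compactOp_linear_continuousP Phi).1 Phi_continuous.
apply: contrapT => unb.
have unbounded n : exists a, rnorm a <= halfpow n ^+ 4 /\ n%:R < rnorm (Psi a).
  have h4 : (0 : R) < halfpow n ^+ 4 by rewrite exprn_gt0// halfpow_gt0.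
  (* If no such a exists for this n, rescaling an arbitrary operator to norm 16^-n bounds [Psi]
     globally by n * 16^n. *)
  apply: contrapT => na; apply: unb; exists (n%:R / halfpow n ^+ 4) => a.
  have [->|a0] := eqVneq a 0; first by rewrite linear0 !rnorm0 mulr0.
  have ra : 0 < rnorm a by rewrite lt_def rnorm_eq0 a0 rnorm_ge0.
  pose l : R := halfpow n ^+ 4 / rnorm a; have l0 : 0 < l by rewrite divr_gt0.
  rewrite leNgt; apply/negP => ha; apply: na; exists (l%:C *: a).
  rewrite linearZ !rnormZr ?(ltW l0)//; split; first by rewrite divfK ?gt_eqF.
  rewrite mulrC -ltr_pdivrMr//; apply: le_lt_trans ha.
  by rewrite /l invf_div mulrA mulrAC.
have [a aP] := choice unbounded.
have [c cP] := common_factor (fun n => (aP n).1).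
(* This bounds |Psi c| |Phi d| |Psi c| for every factor d of norm at most 128, uniformly in n; any
   index above K then gives the contradiction. The absolute value covers a negative [M]. *)
pose K := rnorm (Psi c) * (`|M| * 128) * rnorm (Psi c).
have K0 : 0 <= K by rewrite !mulr_ge0 ?rnorm_ge0.
have [d dn ad] := cP (Num.bound K).
have := lt_trans (archi_boundP K0) (aP (Num.bound K)).2; rewrite ltNge => /negP; apply.
rewrite ad Phi_Psi_jordan_triple.2.
apply: le_trans (rnorm_mul _ _) _; rewrite ler_wpM2r ?rnorm_ge0//.
apply: le_trans (rnorm_mul _ _) _; rewrite ler_wpM2l ?rnorm_ge0//.
apply: le_trans (PhiM d) _.
apply: le_trans (ler_wpM2r (rnorm_ge0 d) (ler_norm M)) _.
by rewrite ler_wpM2l.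
Qed.
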